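(* Let $k \ge 1$ be an integer. If $G$ is a connected graph that contains a cycle and has girth $g$, then \[ \gamma_k(G) \ge \frac{g}{2k+1}. \]
   Context: All graphs are finite, simple and undirected. The girth of a graph containing a cycle is the length of a shortest cycle in it. For vertices $u,v$ of a graph $G$, $d_G(u,v)$ is the number of edges of a shortest $(u,v)$-path. A set $S \subseteq V(G)$ is a $k$-dominating set of $G$ if every vertex of $G$ is at distance at most $k$ in $G$ from some vertex of $S$. The $k$-domination number $\gamma_k(G)$ is the minimum cardinality of a $k$-dominating set of $G$. *)

(* Defs.v *)
From mathcomp Require Import all_boot.

Set Implicit Arguments.
Unset Strict Implicit.
Unset Printing Implicit Defensive.

Record graph := Graph {
  vertex :> finType;
  adj : rel vertex;
  adj_sym : symmetric adj;
  adj_irr : irreflexive adj }.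

Definition connected (G : graph) : Prop := forall u v : G, connect (@adj G) u v.

(* A path of n edges from u is u followed by n further vertices, all distinct. *)
Definition has_path (G : graph) (u v : G) (n : nat) : bool :=
  [exists p : n.-tuple G,
    [&& path (@adj G) u p, last u p == v & uniq (u :: p)]].

(* A path has fewer than #|G| edges, so the search below is exhaustive; the
   result is the junk value #|G| when v is not reachable from u. *)
Definition dist (G : graph) (u v : G) : nat := find (has_path u v) (iota 0 #|G|).

(* Without the bound 3 <= n, [ucycle] would also accept the empty sequence and
   a single edge traversed back and forth. *)
Definition has_cycle_of_length (G : graph) (n : nat) : bool :=
  (3 <= n) && [exists c : n.-tuple G, ucycleb (@adj G) c].

Definition has_cycle (G : graph) : Prop := exists n, has_cycle_of_length G n.

Definition girth (G : graph) (cycG : has_cycle G) : nat := ex_minn cycG.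

(* The [connect] conjunct excludes the junk value of [dist], i.e. vertices in
   different components are at infinite distance. *)
Definition k_dominating (G : graph) (k : nat) (S : {set G}) : bool :=
  [forall v : G, exists u in S, connect (@adj G) u v && (dist u v <= k)].

Definition k_dominating_card (G : graph) (k n : nat) : bool :=
  [exists S : {set G}, k_dominating k S && (#|S| == n)].

Lemma dist_refl (G : graph) (u : G) : dist u u = 0.
Proof.
have u0 : has_path u u 0 by apply/existsP; exists [tuple]; rewrite /= eqxx.
rewrite /dist; have : 0 < #|G| by apply/card_gt0P; exists u.
by case: #|G| => //= n _; rewrite u0.
Qed.

Lemma k_dominating_setT (G : graph) (k : nat) : k_dominating k [set: G].
Proof.
apply/forallP => v; apply/exists_inP; exists v; first exact: in_setT.
by rewrite connect0 dist_refl.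
Qed.

Lemma ex_k_dominating_card (G : graph) (k : nat) :
  exists n, k_dominating_card G k n.
Proof.
by exists #|[set: G]|; apply/existsP; exists setT; rewrite k_dominating_setT eqxx.
Qed.

Definition k_domination_number (G : graph) (k : nat) : nat :=
  ex_minn (ex_k_dominating_card G k).

(* Main.v *)
Require Import Defs.
From mathcomp Require Import all_boot all_order all_algebra.
From mathcomp Require Import zify.
Import Order.TTheory GRing.Theory Num.Theory.
Local Open Scope ring_scope.

(** Let [C] be a cycle of length [g], the girth. Two distinct simple paths with
    the same ends close up to a cycle, so a simple path is determined by its
    ends once we know that it is short enough.
    A ball [B] of radius [k] containing all of [C] forces [g <= 2k+1]: a vertex
    of [C] farthest from the centre would otherwise have the same last step to
    it from both of its neighbours on [C].
    If [C] leaves [B] and [4k < g], two vertices of [C] in [B] are joined by a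
    simple path of length at most [2k] inside [B], which by uniqueness is one of
    the two arcs of [C], namely the one that stays inside [B]; hence [B] meets
    [C] in at most [2k+1] vertices.
    Let [S] be a minimum [k]-dominating set with [g > (2k+1)|S|]. If [|S| = 1],
    the only ball contains [C]; if [|S| >= 2], then [4k < g], and summing over
    the balls around [S] gives [g <= (2k+1)|S|]. *)

Local Open Scope nat_scope.

(** Everything counted lies between the first and the last hit, and fewer than [n] entries separate
    those two. *)
Lemma count_window (T : Type) (a : pred T) (n : nat) (s : seq T) :
  (forall l x m y r, s = l ++ x :: m ++ y :: r -> a x -> a y -> size m < n) ->
  count a s <= n.+1.
Proof.
move=> gap.
have [has_s | no_s] := boolP (has a s); last first.
  by move: no_s; rewrite has_count -leqNgt leqn0 => /eqP->.
case/split_find: has_s gap => x s1 s2 ax no_s1 gap.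
rewrite count_cat -cats1 count_cat /= ax.
move: no_s1; rewrite has_count -leqNgt leqn0 => /eqP->; rewrite addn0 /= !add0n.
have gap2 m y r : s2 = m ++ y :: r -> a y -> size m < n.
  by move=> def_s2 ay; apply: (gap s1 x m y r _ ax ay); rewrite def_s2 cat_rcons.
rewrite add1n ltnS; elim/last_ind: s2 {gap} gap2 => [|t z IHt] // gap2.
have [az | naz] := boolP (a z).
  apply: leq_trans (count_size _ _) _; rewrite size_rcons.
  by apply: (gap2 t z [::]) => //; rewrite cats1.
rewrite -cats1 count_cat /= (negPf naz) !addn0; apply: IHt => m y r def_t.
by apply: (gap2 m y (rcons r z)); rewrite def_t rcons_cat.
Qed.

(** * Closing two paths up to a cycle *)

Section Graph.

Variable G : graph.
Implicit Types (x y s : G) (p q c : seq G).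
Local Notation adj := (@adj G).

Lemma path_rev x p :
  path adj x p -> path adj (last x p) (rev (belast x p)).
Proof.
by rewrite rev_path; rewrite (eq_path (e' := adj)) // => u v; apply: adj_sym.
Qed.

(** After the common prefix is dropped, let [w] be the first vertex of [p] that lies on [q]. The two
    initial segments ending at [w] form the cycle. *)
Lemma distinct_paths_cycle x p q :
    path adj x p -> path adj x q -> last x p = last x q ->
    uniq (x :: p) -> uniq (x :: q) -> p <> q ->
  exists2 c, ucycle adj c & 3 <= size c <= size p + size q.
Proof.
elim: p x q => [|a p IHp] x [|b q] //.
- by move=> _ _ /= -> _ /andP[]; rewrite mem_last.
- by move=> _ _ /= <- /andP[]; rewrite mem_last.
have [<- | neq_ab] := eqVneq a b.
  move=> /andP[_ pp] /andP[_ pq] eq_last /andP[_ up] /andP[_ uq] neq.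
  have [|c uc /andP[c3 cs]] := IHp a q pp pq eq_last up uq.
    by move=> eq_pq; apply: neq; rewrite eq_pq.
  by exists c => //; rewrite c3; apply: leq_trans cs (leq_add _ _) => /=.
move=> pp pq eq_last up uq _.
have meet : has (mem (b :: q)) (a :: p).
  by apply/hasP; exists (last a p); [exact: mem_last | rewrite [last a p]eq_last /= mem_last].
move: meet pp pq up uq; move def_p: (a :: p) => p'; move def_q: (b :: q) => q' meet.
case/split_find: meet def_p => w p1 p2 w_q no_p1 def_p.
case/path.splitP: w_q def_q no_p1 => q1 q2 def_q no_p1 pp pq up uq.
have no_p1q z : z \in p1 -> z \notin rcons q1 w ++ q2.
  by move=> zp; move/hasPn: no_p1 => /(_ z zp).
exists (x :: rcons p1 w ++ rev q1).
  apply/andP; split.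
    rewrite /cycle rcons_cat cat_path last_rcons.
    move: pp pq; rewrite !cat_path => /andP[-> _] /andP[/path_rev + _].
    by rewrite last_rcons belast_rcons rev_cons.
  move: up uq; rewrite /= !mem_cat !mem_rcons !inE mem_rev !cat_uniq !rcons_uniq.
  rewrite rev_uniq !negb_or.
  case/andP=> /andP[/andP[-> ->] _] /andP[/andP[-> ->] _].
  case/andP=> /andP[/andP[_ ->] _] /andP[/andP[w_q1 ->] _] /=; rewrite andbT.
  apply/hasPn => z; rewrite mem_rev => zq1 /=; rewrite mem_rcons inE negb_or.
  apply/andP; split; first by apply: contraNneq w_q1 => <-.
  by apply/negP => /no_p1q; rewrite mem_cat mem_rcons inE zq1 orbT.
rewrite /= !size_cat !size_rcons size_rev; apply/andP; split; last by lia.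
(* The length is below 3 only if both segments are single edges to [w], but then [a = b]. *)
case: p1 q1 def_p def_q {no_p1 no_p1q pp pq up uq eq_last} => [|? ?] [|? ?] /=; try lia.
by move=> [ea _] [eb _]; rewrite ea eb eqxx in neq_ab.
Qed.

(** * Distances and geodesics *)

Lemma has_path_lt x y n : has_path x y n -> n < #|G|.
Proof.
case/existsP=> p /and3P[_ _ /card_uniqP eq_n].
by have := max_card (mem (x :: p)); rewrite eq_n /= size_tuple.
Qed.

Lemma has_pathI x p : path adj x p -> uniq (x :: p) -> has_path x (last x p) (size p).
Proof. by move=> pp up; apply/existsP; exists (in_tuple p); rewrite pp eqxx up. Qed.

(** A simple path has fewer than [#|G|] edges, so the search defining [dist] succeeds and its junk
    value does not arise. *)
Lemma has_path_dist x y : connect adj x y -> has_path x y (dist x y).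
Proof.
case/connectP=> p /shortenP[q pq uq _] ->.
have hq := has_pathI x q pq uq; have lt_q := has_path_lt _ _ _ hq.
have has_q : has (has_path x (last x q)) (iota 0 #|G|).
  by apply/hasP; exists (size q); rewrite // mem_iota.
have := nth_find 0 has_q; rewrite nth_iota //.
by move: has_q; rewrite has_find size_iota.
Qed.

Lemma dist_le_size x p : path adj x p -> dist x (last x p) <= size p.
Proof.
case/shortenP=> q pq uq /(uniq_leq_size (andP uq).2) le_qp.
have hq := has_pathI x q pq uq; apply: leq_trans le_qp.
rewrite leqNgt; apply/negP => /(before_find 0).
by rewrite nth_iota ?add0n ?hq //; apply: has_path_lt hq.
Qed.

Lemma geodesic x y : connect adj x y ->
  exists p, [/\ path adj x p, last x p = y, uniq (x :: p) & size p = dist x y].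
Proof.
case/has_path_dist/existsP=> p /and3P[pp /eqP lp up].
by exists p; rewrite size_tuple.
Qed.

(** * Balls *)

Definition ball s k : pred G := [pred x | connect adj s x && (dist s x <= k)].

Lemma path_sub_ball s k p x :
  path adj s p -> size p <= k -> x \in s :: p -> x \in ball s k.
Proof.
move=> pp le_pk xp; case/splitPl: xp pp le_pk => p1 p2 <-.
rewrite cat_path size_cat => /andP[pp1 _] le_k.
rewrite inE; apply/andP; split; first by apply/connectP; exists p1.
by apply: leq_trans (dist_le_size s p1 pp1) _; lia.
Qed.

(** Join geodesics through the centre [s] and shorten the walk; shortening adds no vertices, so the
    path stays in the ball. *)
Lemma ball_path s k x y : x \in ball s k -> y \in ball s k ->
  exists p, [/\ path adj x p, last x p = y, uniq (x :: p), size p <= 2 * k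
              & {subset x :: p <= ball s k}].
Proof.
case/andP=> /geodesic[px [ppx lpx upx spx]] dx.
case/andP=> /geodesic[py [ppy lpy upy spy]] dy.
have rpx := path_rev _ _ ppx; rewrite lpx in rpx.
have lrev : last x (rev (belast s px)) = s.
  by case: (px) lpx => //= a l _; rewrite rev_cons last_rcons.
have pw : path adj x (rev (belast s px) ++ py) by rewrite cat_path rpx lrev.
have lw : last x (rev (belast s px) ++ py) = y by rewrite last_cat lrev.
have w_ball : {subset x :: rev (belast s px) ++ py <= ball s k}.
  move=> z; rewrite inE mem_cat mem_rev => /or3P[/eqP->|zx|zy].
  - by apply: (path_sub_ball s k px); rewrite ?spx // -lpx mem_last.
  - by apply: (path_sub_ball s k px); rewrite ?spx ?mem_belast.
  - by apply: (path_sub_ball s k py); rewrite ?spy // inE zy orbT.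
case/shortenP: pw lw => q pq uq sub_q lq; exists q; split=> //.
  apply: leq_trans (uniq_leq_size (andP uq).2 sub_q) _.
  by rewrite size_cat size_rev size_belast spx spy mul2n -addnn leq_add.
by move=> z; rewrite inE => /predU1P[->|/sub_q zq]; apply: w_ball;
  rewrite inE ?eqxx ?zq ?orbT.
Qed.

(** * Balls against a shortest cycle *)

Section ShortestCycle.

Variable g : nat.
Hypothesis girth_ge : forall c, ucycle adj c -> 3 <= size c -> g <= size c.

Lemma short_path_unique x p q :
    path adj x p -> path adj x q -> last x p = last x q ->
    uniq (x :: p) -> uniq (x :: q) -> size p + size q < g ->
  p = q.
Proof.
move=> pp pq lpq up uq lt_g; apply/eqP/contraT => /eqP neq.
have [c uc /andP[c3 cs]] := distinct_paths_cycle x p q pp pq lpq up uq neq.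
by have := leq_trans (girth_ge c uc c3) cs; rewrite leqNgt lt_g.
Qed.

Lemma cycle_in_ball s k c : ucycle adj c -> 3 <= size c ->
  {subset c <= ball s k} -> g <= 2 * k + 1.
Proof.
move=> uc c3 c_ball; rewrite leqNgt; apply/negP => lt_g.
have [x0 x0c] : exists x0, x0 \in c by case: (c) c3 => // a l _; exists a; rewrite mem_head.
case: (@arg_maxnP _ x0 (mem c) (dist s) x0c) => x xc x_max.
have [i c' def_c] := rot_to xc.
have mem_c z : (z \in c) = (z \in x :: c') by rewrite -def_c mem_rot.
have uc' : ucycle adj (x :: c') by rewrite -def_c rot_ucycle.
have sc' : size (x :: c') = size c by rewrite -def_c size_rot.
have [px [ppx lpx upx spx]] := geodesic s x (andP (c_ball x xc)).1.
have max_k : dist s x <= k := (andP (c_ball x xc)).2.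
have last_step y : y \in c -> adj y x ->
    exists2 p, last s p = y & rcons p x = px.
  move=> yc eyx; have [p [pp lp up sp]] := geodesic s y (andP (c_ball y yc)).1.
  have le_yx : dist s y <= dist s x := x_max y yc.
  exists p => //; apply: (short_path_unique s) => //.
  - by rewrite rcons_path pp lp.
  - by rewrite last_rcons.
  - rewrite -rcons_cons rcons_uniq up andbT; apply/negP => xp.
    have neq_xy : x != y by apply: contraTneq eyx => ->; rewrite adj_irr.
    (* If the geodesic to [y] passed through [x], then [x] would be strictly closer to [s] than [y],
       against the choice of [x]. *)
    case/splitPl: xp pp lp sp => p1 p2 lp1.
    rewrite cat_path last_cat size_cat lp1 => /andP[pp1 _] lp2 sp.
    have := dist_le_size s p1 pp1; rewrite lp1.
    case: p2 lp2 sp => [/= exy|? ? _ /=]; last by lia.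
    by rewrite exy eqxx in neq_xy.
  (* The lengths are at most [k + 1] and [k], which add up to less than [g]. *)
  - by rewrite size_rcons; lia.
case: c' uc' sc' mem_c {def_c} => [|y c'] uc' sc' mem_c; first by rewrite -sc' in c3.
case/lastP: c' uc' sc' mem_c => [|c' z] uc' sc' mem_c; first by rewrite -sc' in c3.
case/andP: uc'; rewrite /cycle rcons_path /= last_rcons => /andP[/andP[exy _] ezx].
case/and3P=> _ yc' _.
have [||p lp ep] := last_step y; first by rewrite mem_c !inE eqxx orbT.
  by rewrite adj_sym.
have [|//|q lq eq_] := last_step z; first by rewrite mem_c !inE mem_rcons inE eqxx !orbT.
(* Both extended geodesics equal [px], so the neighbours [y] and [z] of [x] coincide, although the
   cycle has no repetition. *)
have /rcons_inj[epq] : rcons p x = rcons q x by rewrite ep.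
by case/negP: yc'; rewrite -lp epq lq mem_rcons mem_head.
Qed.

Lemma count_ball_cycle s k c : ucycle adj c -> size c = g -> 3 <= g -> 4 * k < g ->
  count (ball s k) c <= 2 * k + 1.
Proof.
move=> uc sc g3 lt_g; rewrite addn1.
have [/allP c_ball | /allPn[x0 x0c x0_ball]] := boolP (all (ball s k) c).
  have := cycle_in_ball s k c uc; rewrite sc => /(_ g3 c_ball) le_g.
  by apply: leq_trans (count_size _ _) _; rewrite sc; lia.
(* Starting the cycle at a vertex outside the ball turns it into a linear sequence, to which
   [count_window] applies with [n = 2 * k]. *)
have [i c' def_c] := rot_to x0c.
have uc' : ucycle adj (x0 :: c') by rewrite -def_c rot_ucycle.
have sc' : size (x0 :: c') = g by rewrite -def_c size_rot.
have -> : count (ball s k) c = count (ball s k) (x0 :: c').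
  by rewrite -def_c; apply/permP; rewrite perm_sym perm_rot.
rewrite -[count _ (_ :: _)]/(ball s k x0 + _) (negPf x0_ball) add0n.
apply: count_window => l x m y r def_c' x_ball y_ball.
have [p [pp lp up sp p_ball]] := ball_path s k x y x_ball y_ball.
have [cy un] := andP uc'; rewrite /cycle def_c' in cy; rewrite def_c' in un.
(* The other arc from [x] to [y], running backwards through [x0]. *)
pose q := rev l ++ x0 :: rcons (rev r) y.
have perm1 : perm_eq (x0 :: c') (x :: rcons m y ++ x0 :: l ++ r).
  by rewrite def_c' -(cat_rcons y); apply/permPl/(perm_catCA (x0 :: l) (x :: rcons m y)).
have perm2 : perm_eq (x0 :: c') (x :: q ++ m).
  rewrite def_c' /q -cats1; apply/permP => P.
  rewrite /= !count_cat /= !count_cat /= !count_rev.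
  move: (P x0 : nat) (P x : nat) (P y : nat) (count P l) (count P m) (count P r).
  by clear; lia.
have sg : (size m + size q).+1 = g.
  by rewrite -sc' (perm_size perm2) /= size_cat addnC.
have /and5P[path_l exl path_m] :
    [&& path adj x0 l, adj (last x0 l) x, path adj x (rcons m y), path adj y r
      & adj (last y r) x0].
  move: cy; rewrite rcons_cat /= rcons_cat /= -cat_rcons -cat_rcons cat_path.
  rewrite last_rcons cat_path last_rcons rcons_path [path _ _ (rcons r x0)]rcons_path.
  by case/and3P=> /andP[-> ->] -> /andP[-> ->].
move=> path_r erx.
have un_arc a b : perm_eq (x0 :: c') (x :: a ++ b) -> uniq (x :: a).
  by rewrite -cat_cons => /perm_uniq; rewrite (andP uc').2 cat_uniq => /esym/and3P[].
(* The arcs have lengths [size m + 1] and [size q], with sum [g]. If [p] is too long to be compared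
   with the first, then [size q <= size p <= 2 * k], and [4 * k < g] allows comparison with the
   second. *)
have [lt1 | ge1] := ltnP (size p + (size m).+1) g.
  have ep : p = rcons m y.
    apply: (short_path_unique x); rewrite ?last_rcons ?size_rcons //.
    exact: un_arc perm1.
  by rewrite ep size_rcons in sp.
have ep : p = q.
  have lt_pq : size p + size q < g.
    by move: sp lt_g ge1 sg; move: (size p) (size q) (size m); clear; lia.
  apply: (short_path_unique x _ _ pp _ _ up _ lt_pq).
  - have := path_rev x0 (rcons l x); rewrite rcons_path path_l exl last_rcons.
    rewrite belast_rcons rev_cons /q -cat_rcons cat_path last_rcons => -> //=.
    have := path_rev y (rcons r x0); rewrite rcons_path path_r erx last_rcons.
    by rewrite belast_rcons rev_cons => ->.
  - by rewrite lp /q last_cat /= last_rcons.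
  - exact: un_arc perm2.
(* The arc [q] contains [x0], while [p] stays in the ball. *)
by case/negP: x0_ball; apply: p_ball; rewrite ep inE mem_cat mem_head !orbT.
Qed.

(** Double counting: each entry of [c] lies in at least one of the balls. *)
Lemma ucycle_sum_balls (S : {set G}) k c : k_dominating k S ->
  size c <= \sum_(s in S) count (ball s k) c.
Proof.
move=> /forallP dom; rewrite -sum1_size.
under [X in _ <= X]eq_bigr => s _ do rewrite -sum1_count big_mkcond.
rewrite exchange_big /=; apply: leq_sum => x _.
have /exists_inP[s sS sx] := dom x.
by rewrite (bigD1 s) //= (_ : ball s k x) //; apply: sx.
Qed.

Lemma girth_le_dominating (S : {set G}) k c :
  ucycle adj c -> size c = g -> 3 <= g -> k_dominating k S ->
  g <= (2 * k + 1) * #|S|.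
Proof.
move=> uc sc g3 domS; rewrite leqNgt; apply/negP => lt_g.
have [S_small | S_big] := leqP #|S| 1.
  have /forallP dom := domS.
  have [x0 _] : exists x0, x0 \in c.
    by case: (c) sc g3 => [<- //|a l _ _]; exists a; rewrite mem_head.
  have /exists_inP[s sS _] := dom x0.
  have def_S : S = [set s] by apply/esym/eqP; rewrite eqEcard sub1set sS cards1.
  have c_ball : {subset c <= ball s k}.
    by move=> x _; have /exists_inP[t] := dom x; rewrite def_S => /set1P->.
  have := cycle_in_ball s k c uc; rewrite sc => /(_ g3 c_ball).
  by move: lt_g; rewrite def_S cards1; lia.
have le_g : g <= \sum_(s in S) (2 * k + 1).
  rewrite -[X in X <= _]sc; apply: leq_trans (ucycle_sum_balls S k c domS) _.
  (* With [#|S| >= 2], the assumption [lt_g] yields [4 * k + 2 < g]. *)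
  by apply: leq_sum => s _; apply: count_ball_cycle => //; nia.
by move: le_g; rewrite sum_nat_const; lia.
Qed.

End ShortestCycle.

End Graph.

Local Close Scope nat_scope.

Theorem theorem11 (k : nat) (hk : (1 <= k)%N) (G : graph)
    (conG : connected G) (cycG : has_cycle G) :
  (girth cycG)%:R / (2 * k + 1)%:R <= (k_domination_number G k)%:R :> rat.
Proof.
(* Clearing the positive denominator leaves an inequality of natural numbers. *)
rewrite ler_pdivrMr ?ltr0n ?addn1 // -natrM ler_nat mulnC -addn1.
rewrite /girth /k_domination_number.
case: ex_minnP => g /andP[g3 /existsP[c uc]] g_min.
case: ex_minnP => n /existsP[S /andP[domS /eqP <-]] _.
apply: (girth_le_dominating G g _ S k c) => //; last by rewrite size_tuple.
move=> c' uc' c3; apply: g_min; rewrite /has_cycle_of_length c3.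
by apply/existsP; exists (in_tuple c').
Qed.
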